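(* If $f\in\mathcal B_\mu$ for some $\mu\in(0,1]$ and $\lambda>0$, then $f^{\lambda}\in\mathcal B_{\mu([\lambda]+1)}$, where $[\lambda]$ denotes the integer part of $\lambda$.
   Context: A function $g:(0,\infty)\to\mathbb R$ is completely monotonic if it is infinitely often differentiable and $(-1)^n g^{(n)}(x)\ge 0$ for all $n=0,1,2,\ldots$ and all $x>0$. For $\lambda>0$, a $C^\infty$-function $f:(0,\infty)\to(0,\infty)$ belongs to the class $\mathcal B_\lambda$ of generalized Bernstein functions of order $\lambda$ if $x\mapsto x^{1-\lambda}f'(x)$ is completely monotonic. *)

(* Defs.v *)
From Stdlib Require Import Reals.
From Coquelicot Require Import Coquelicot.
Open Scope R_scope.

(* Functions on (0,oo) are represented by functions R -> R of which only the
   values at positive arguments matter: (0,oo) is open, so the existence and the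
   value of every derivative at x > 0 depend only on the restriction to (0,oo). *)

Definition smooth_pos (g : R -> R) : Prop :=
  forall (n : nat) (x : R), 0 < x -> ex_derive_n g n x.

Definition completely_monotonic (g : R -> R) : Prop :=
  smooth_pos g /\
  forall (n : nat) (x : R), 0 < x -> 0 <= (-1) ^ n * Derive_n g n x.

(* The class B_lambda, meant for lambda > 0. *)
Definition gen_bernstein (lambda : R) (f : R -> R) : Prop :=
  (forall x : R, 0 < x -> 0 < f x) /\
  smooth_pos f /\
  completely_monotonic (fun x => Rpower x (1 - lambda) * Derive f x).

(* Main.v *)
Require Import Defs.
From Stdlib Require Import Reals.
From Coquelicot Require Import Coquelicot.
From Stdlib Require Import ZArith Lra Lia.
Open Scope R_scope.

(** The theorem reduces to writing the function whose complete monotonicity is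
    claimed as a product of completely monotonic (CM) factors.  Put
    [h x = x^(1-mu) f'(x)], which is CM by assumption, and [m = [lambda]].
    Then, for [x > 0],

      [x^(1-mu(m+1)) (f^lambda)'(x)
         = lambda (x^(-mu) f(x))^m f(x)^(lambda-m-1) h(x)].

    - CM functions are closed under products, because the product rule has only
      plus signs once each derivative is taken with its sign.
    - [f' = x^(mu-1) h] is CM since [mu <= 1].  For [f > 0] with CM derivative
      and [a <= 0], the power [f^a] is CM: its derivative is
      [- (-a) f^(a-1) f'], so an induction over all [a <= 0] at once applies.
      This covers the factor [f^(lambda-m-1)], as [lambda - m - 1 < 0], and,
      with [f] replaced by the identity, all nonpositive powers of [x].
    - The function [G x = x^(-mu) f(x)] is CM.  It solves the Euler equation
      [x G' + mu G = h].  Differentiating it shows that the signed derivatives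
      [a_k = (-1)^k G^(k)] satisfy [x a_(k+1) = (k + mu) a_k - b_k] with
      [b_k = (-1)^k h^(k) >= 0]; hence [x^(k+mu) a_k] is nondecreasing.  If
      [a_(k+1)] were negative somewhere, then [x^(k+mu) a_k] would grow at
      least like [c ln x] near 0 and thus be negative there, against
      [a_k >= 0].  So the signs propagate from [a_0 = G > 0], without any
      integral representation.

    Smoothness of [f^lambda] and of [G] comes from the same closure lemmas,
    stated for a general set of admissible values in place of the nonnegative
    reals. *)

(** * Functions with admissible signed derivatives *)

(** [K] is the set of values allowed for the signed derivatives
    [(-1)^k g^(k)]: the nonnegative reals give complete monotonicity, all reals
    give mere smoothness.  Quantifying existentially over the derivative
    at each level keeps higher-order product and chain rules out of the
    inductions below. *)
Fixpoint alternating (K : R -> Prop) (n : nat) (g : R -> R) : Prop :=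
  (forall x, 0 < x -> K (g x)) /\
  match n with
  | O => True
  | S n' => exists g1, (forall x, 0 < x -> is_derive g x (- g1 x)) /\
                       alternating K n' g1
  end.

Definition semicone (K : R -> Prop) : Prop :=
  (forall a, 0 <= a -> K a) /\
  (forall a b, K a -> K b -> K (a + b)) /\
  (forall a b, K a -> K b -> K (a * b)).

Definition anyreal (_ : R) : Prop := True.

Lemma semicone_nonneg : semicone (Rle 0).
Proof.
  split; [|split]; intros; try lra; now apply Rmult_le_pos.
Qed.

Lemma semicone_anyreal : semicone anyreal.
Proof. repeat split. Qed.

Lemma locally_pos (P : R -> Prop) (x : R) :
  0 < x -> (forall y, 0 < y -> P y) -> locally x P.
Proof.
  intros hx hP.
  apply locally_interval with (a := Finite 0) (b := p_infty); simpl; auto.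
Qed.

Lemma is_derive_ext_pos (f g : R -> R) (x l : R) :
  0 < x -> (forall y, 0 < y -> f y = g y) -> is_derive f x l -> is_derive g x l.
Proof.
  intros hx hfg. apply is_derive_ext_loc. now apply locally_pos.
Qed.

Lemma alternating_weaken (K L : R -> Prop) (n : nat) (g : R -> R) :
  (forall a, K a -> L a) -> alternating K n g -> alternating L n g.
Proof.
  intros hKL; revert g; induction n as [|n IH]; intros g [h0 h1].
  - now split; auto.
  - destruct h1 as [g1 [hd h1]]. split; [now auto|]. exists g1; auto.
Qed.

Lemma alternating_pred (K : R -> Prop) (n : nat) (g : R -> R) :
  alternating K (S n) g -> alternating K n g.
Proof.
  revert g; induction n as [|n IH]; intros g [h0 [g1 [hd h1]]].
  - now split.
  - split; [exact h0|]. exists g1; auto.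
Qed.

Lemma alternating_ext (K : R -> Prop) (n : nat) (f g : R -> R) :
  (forall x, 0 < x -> f x = g x) -> alternating K n f -> alternating K n g.
Proof.
  intros hfg hf.
  destruct n as [|n]; destruct hf as [h0 h1]; split;
    try (intros x hx; rewrite <- hfg; now auto); try easy.
  destruct h1 as [g1 [hd h1]]. exists g1; split; [|exact h1].
  intros x hx. apply is_derive_ext_pos with f; auto.
Qed.

Lemma alternating_plus (K : R -> Prop) (n : nat) (f g : R -> R) :
  semicone K -> alternating K n f -> alternating K n g ->
  alternating K n (fun x => f x + g x).
Proof.
  intros [_ [hplus _]]; revert f g.
  induction n as [|n IH]; intros f g [f0 hf] [g0 hg];
    (split; [intros x hx; now apply hplus; auto|]); [exact I|].
  destruct hf as [f1 [df hf]], hg as [g1 [dg hg]].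
  exists (fun x => f1 x + g1 x); split; [|now apply IH].
  intros x hx. replace (- (f1 x + g1 x)) with (- f1 x + - g1 x) by ring.
  apply (is_derive_plus f g x (- f1 x) (- g1 x)); auto.
Qed.

Lemma is_derive_mult_R (f g : R -> R) (x df dg : R) :
  is_derive f x df -> is_derive g x dg ->
  is_derive (fun y => f y * g y) x (df * g x + f x * dg).
Proof.
  intros hf hg. apply (is_derive_mult f g x df dg hf hg).
  intros; apply Rmult_comm.
Qed.

Lemma alternating_mult (K : R -> Prop) (n : nat) (f g : R -> R) :
  semicone K -> alternating K n f -> alternating K n g ->
  alternating K n (fun x => f x * g x).
Proof.
  intros hK; revert f g.
  induction n as [|n IH]; intros f g hf hg.
  - destruct hf as [f0 _], hg as [g0 _], hK as [_ [_ hmult]].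
    split; [|exact I]. intros x hx; apply hmult; auto.
  - pose proof (alternating_pred K n f hf) as hf'.
    pose proof (alternating_pred K n g hg) as hg'.
    destruct hf as [f0 [f1 [df hf]]], hg as [g0 [g1 [dg hg]]].
    split.
    + intros x hx; apply (proj2 (proj2 hK)); auto.
    + exists (fun x => f1 x * g x + f x * g1 x); split.
      * intros x hx.
        replace (- (f1 x * g x + f x * g1 x))
          with (- f1 x * g x + f x * - g1 x) by ring.
        apply is_derive_mult_R; auto.
      * apply alternating_plus; auto.
Qed.

Lemma alternating_const (K : R -> Prop) (n : nat) (c : R) :
  semicone K -> K c -> alternating K n (fun _ => c).
Proof.
  intros hK; revert c; induction n as [|n IH]; intros c hc;
    (split; [now auto|]); [exact I|].
  exists (fun _ => 0); split.
  - intros x hx. rewrite Ropp_0. apply (is_derive_const c x).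
  - apply IH, (proj1 hK); lra.
Qed.

Lemma alternating_pow (K : R -> Prop) (n m : nat) (f : R -> R) :
  semicone K -> alternating K n f -> alternating K n (fun x => f x ^ m).
Proof.
  intros hK hf; induction m as [|m IH]; simpl.
  - apply alternating_const; [exact hK|]. apply (proj1 hK); lra.
  - now apply alternating_mult.
Qed.

Lemma is_derive_Rpower_comp (f : R -> R) (x d a : R) :
  0 < f x -> is_derive f x d ->
  is_derive (fun y => Rpower (f y) a) x (a * Rpower (f x) (a - 1) * d).
Proof.
  intros hpos hd.
  rewrite Rmult_comm.
  apply (is_derive_comp (fun y => Rpower y a) f x _ d); [|exact hd].
  apply is_derive_Reals. now apply derivable_pt_lim_power.
Qed.

(** The exponent varies in the induction: differentiating [f^a] lowers the
    exponent to [a - 1], and [-(a - 1) = -a + 1] stays in [K]. *)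
Lemma alternating_Rpower (K : R -> Prop) (f f1 : R -> R) (n : nat) (a : R) :
  semicone K -> (forall x, 0 < x -> 0 < f x) ->
  (forall x, 0 < x -> is_derive f x (f1 x)) ->
  (forall k, alternating K k f1) ->
  K (- a) -> alternating K n (fun x => Rpower (f x) a).
Proof.
  intros hK hpos hd hf1; revert a.
  induction n as [|n IH]; intros a ha;
    (split; [intros x hx; apply (proj1 hK), Rlt_le, exp_pos|]); [exact I|].
  exists (fun x => - a * (Rpower (f x) (a - 1) * f1 x)); split.
  - intros x hx.
    replace (- (- a * (Rpower (f x) (a - 1) * f1 x)))
      with (a * Rpower (f x) (a - 1) * f1 x) by ring.
    apply is_derive_Rpower_comp; auto.
  - apply alternating_mult; [exact hK|now apply alternating_const|].
    apply alternating_mult; auto. apply IH.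
    replace (- (a - 1)) with (- a + 1) by ring.
    apply (proj1 (proj2 hK)); [exact ha|]. apply (proj1 hK); lra.
Qed.

Lemma alternating_Rpower_id (K : R -> Prop) (n : nat) (a : R) :
  semicone K -> K (- a) -> alternating K n (fun x => Rpower x a).
Proof.
  intros hK ha.
  apply (alternating_Rpower K (fun x => x) (fun _ => 1)); auto.
  - intros x _. apply (is_derive_id x).
  - intros k. apply alternating_const; [exact hK|]. apply (proj1 hK); lra.
Qed.

(** * Comparison with iterated derivatives *)

Lemma is_derive_signed_Derive_n (g : R -> R) (k : nat) (x : R) :
  smooth_pos g -> 0 < x ->
  is_derive (fun y => (-1) ^ k * Derive_n g k y) x
    (- ((-1) ^ S k * Derive_n g (S k) x)).
Proof.
  intros hs hx.
  replace (- ((-1) ^ S k * Derive_n g (S k) x))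
    with ((-1) ^ k * Derive_n g (S k) x) by (simpl; ring).
  apply is_derive_scal. apply Derive_correct. exact (hs (S k) x hx).
Qed.

Lemma alternating_of_Derive_n (K : R -> Prop) (g : R -> R) (n : nat) :
  smooth_pos g ->
  (forall k x, 0 < x -> K ((-1) ^ k * Derive_n g k x)) ->
  alternating K n g.
Proof.
  intros hs hK.
  assert (H : forall k, alternating K n (fun x => (-1) ^ k * Derive_n g k x)).
  { induction n as [|n IH]; intros k; (split; [now auto|]); [exact I|].
    exists (fun x => (-1) ^ S k * Derive_n g (S k) x); split; [|apply IH].
    intros x hx. now apply is_derive_signed_Derive_n. }
  apply alternating_ext with (2 := H O). intros x _; simpl; ring.
Qed.

(** Generalized over the level [k] at which the chain of witnesses starts, so
    that peeling one witness [h1] off [h] moves one derivative from [n] to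
    [k]. *)
Lemma Derive_n_of_alternating_aux (K : R -> Prop) (g : R -> R) (n k : nat)
    (h : R -> R) :
  alternating K n h ->
  (forall x, 0 < x -> ex_derive_n g k x /\ Derive_n g k x = (-1) ^ k * h x) ->
  forall x, 0 < x ->
    ex_derive_n g (n + k) x /\ K ((-1) ^ (n + k) * Derive_n g (n + k) x).
Proof.
  revert k h; induction n as [|n IH]; intros k h [h0 hn] hk x hx.
  - simpl. destruct (hk x hx) as [hex heq]. split; [exact hex|].
    rewrite heq, <- Rmult_assoc, <- Rpow_mult_distr.
    replace (-1 * -1) with 1 by ring. rewrite pow1, Rmult_1_l. auto.
  - destruct hn as [h1 [hd hn]].
    replace (S n + k)%nat with (n + S k)%nat by lia.
    apply (IH (S k) h1 hn); [|exact hx]. clear x hx; intros x hx.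
    assert (D : is_derive (Derive_n g k) x ((-1) ^ S k * h1 x)).
    { apply is_derive_ext_pos with (fun y => (-1) ^ k * h y); [exact hx| |].
      - intros y hy; symmetry; apply hk, hy.
      - replace ((-1) ^ S k * h1 x) with ((-1) ^ k * - h1 x)
          by (simpl; ring).
        apply is_derive_scal; auto. }
    split.
    + exists ((-1) ^ S k * h1 x). exact D.
    + exact (is_derive_unique _ _ _ D).
Qed.

Lemma Derive_n_of_alternating (K : R -> Prop) (g : R -> R) :
  (forall n, alternating K n g) ->
  forall n x, 0 < x ->
    ex_derive_n g n x /\ K ((-1) ^ n * Derive_n g n x).
Proof.
  intros hg n x hx.
  replace n with (n + 0)%nat by lia.
  apply Derive_n_of_alternating_aux with g; auto.
  intros y _; simpl; split; [exact I|ring].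
Qed.

Lemma completely_monotonic_alternating (g : R -> R) :
  completely_monotonic g <-> forall n, alternating (Rle 0) n g.
Proof.
  split.
  - intros [hs hg] n. now apply alternating_of_Derive_n.
  - intros hg. split; intros n x hx;
      now apply (Derive_n_of_alternating (Rle 0) g hg n x hx).
Qed.

Lemma smooth_pos_alternating (g : R -> R) :
  smooth_pos g <-> forall n, alternating anyreal n g.
Proof.
  split.
  - intros hs n. apply alternating_of_Derive_n; [exact hs|now intros].
  - intros hg n x hx. now apply (Derive_n_of_alternating anyreal g hg n x hx).
Qed.

(** * The Euler equation and sign propagation *)

Lemma is_derive_Rpower_mult (g : R -> R) (x d p : R) :
  0 < x -> is_derive g x d ->
  is_derive (fun t => Rpower t p * g t) x
    (p * Rpower x (p - 1) * g x + Rpower x p * d).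
Proof.
  intros hx hd. apply (is_derive_mult_R (fun t => Rpower t p)); [|exact hd].
  apply is_derive_Reals. now apply derivable_pt_lim_power.
Qed.

Lemma nondecreasing_of_derive (f df : R -> R) (x y : R) :
  x <= y -> (forall t, x <= t <= y -> is_derive f t (df t)) ->
  (forall t, x <= t <= y -> 0 <= df t) -> f x <= f y.
Proof.
  intros hxy hd hpos.
  destruct (MVT_gen f x y df) as [c [hc heq]].
  - intros t. rewrite Rmin_left, Rmax_right by exact hxy. intros; apply hd; lra.
  - intros t. rewrite Rmin_left, Rmax_right by exact hxy. intros ht.
    apply continuity_pt_filterlim, (ex_derive_continuous f t).
    exists (df t); auto.
  - rewrite Rmin_left, Rmax_right in hc by exact hxy.
    assert (0 <= df c * (y - x)) by (apply Rmult_le_pos; [auto|lra]). lra.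
Qed.

(** If [a1 x0 < 0], then [x^(p+1) a1 <= -c < 0] on [(0, x0]], so [x^p a] has
    derivative at least [c / x] there and falls below zero as [x] tends to 0. *)
Lemma nonneg_neg_derive_of_nondecreasing (a a1 : R -> R) (p : R) :
  0 <= p ->
  (forall x, 0 < x -> 0 <= a x) ->
  (forall x, 0 < x -> is_derive a x (- a1 x)) ->
  (forall x y, 0 < x -> x <= y ->
     Rpower x (p + 1) * a1 x <= Rpower y (p + 1) * a1 y) ->
  forall x, 0 < x -> 0 <= a1 x.
Proof.
  intros hp ha hd hmono x0 hx0.
  destruct (Rle_or_lt 0 (a1 x0)) as [|hneg]; [assumption|exfalso].
  set (c := - (Rpower x0 (p + 1) * a1 x0)).
  assert (hc : 0 < c).
  { unfold c. rewrite <- Ropp_mult_distr_r_reverse.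
    apply Rmult_lt_0_compat; [apply exp_pos|lra]. }
  set (u0 := Rpower x0 p * a x0).
  assert (hu0 : 0 <= u0).
  { apply Rmult_le_pos; [apply Rlt_le, exp_pos|auto]. }
  (* The point where the bound u0 + c ln (x / x0) equals -1. *)
  set (s := (u0 + 1) / c).
  assert (hs : 0 < s) by (apply Rdiv_lt_0_compat; lra).
  set (x := x0 * exp (- s)).
  assert (he1 : exp (- s) <= 1).
  { rewrite <- exp_0. apply Rlt_le, exp_increasing. lra. }
  assert (hx : 0 < x) by (apply Rmult_lt_0_compat; [lra|apply exp_pos]).
  assert (hxx0 : x <= x0).
  { unfold x. rewrite <- (Rmult_1_r x0) at 2. apply Rmult_le_compat_l; lra. }
  assert (hw : Rpower x p * a x - c * ln x <= Rpower x0 p * a x0 - c * ln x0).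
  { apply (nondecreasing_of_derive (fun t => Rpower t p * a t - c * ln t)
      (fun t => p * Rpower t (p - 1) * a t + Rpower t p * - a1 t - c * / t));
      [exact hxx0| |].
    - intros t ht. assert (ht0 : 0 < t) by lra.
      apply (is_derive_minus (fun t => Rpower t p * a t) (fun t => c * ln t)).
      + apply is_derive_Rpower_mult; auto.
      + apply is_derive_scal. now apply is_derive_ln.
    - intros t ht. assert (ht0 : 0 < t) by lra.
      assert (0 <= p * Rpower t (p - 1) * a t).
      { apply Rmult_le_pos; [apply Rmult_le_pos|]; auto.
        apply Rlt_le, exp_pos. }
      assert (hb : Rpower t p * - a1 t = - (Rpower t (p + 1) * a1 t) * / t).
      { rewrite Rpower_plus, Rpower_1 by exact ht0. field; lra. }
      assert (c * / t <= - (Rpower t (p + 1) * a1 t) * / t).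
      { apply Rmult_le_compat_r; [apply Rlt_le, Rinv_0_lt_compat, ht0|].
        unfold c. pose proof (hmono t x0 ht0 (proj2 ht)). lra. }
      lra. }
  assert (hln : ln x = ln x0 - s).
  { unfold x. rewrite ln_mult, ln_exp; [ring|lra|apply exp_pos]. }
  assert (hcs : c * s = u0 + 1) by (unfold s; field; lra).
  assert (0 <= Rpower x p * a x).
  { apply Rmult_le_pos; [apply Rlt_le, exp_pos|auto]. }
  rewrite hln in hw. fold u0 in hw. nra.
Qed.

(** Differentiating [x a_1 = q a_0 - b_0], that is, [x g' + q g = h] for
    [g = a_0] and [h = b_0], shifts [q] by one at each order. *)
Lemma euler_equation_iterate (a b : nat -> R -> R) (q : R) :
  (forall k x, 0 < x -> is_derive (a k) x (- a (S k) x)) ->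
  (forall k x, 0 < x -> is_derive (b k) x (- b (S k) x)) ->
  (forall x, 0 < x -> x * a 1%nat x = q * a 0%nat x - b 0%nat x) ->
  forall k x, 0 < x -> x * a (S k) x = (INR k + q) * a k x - b k x.
Proof.
  intros da db h0 k; induction k as [|k IH]; intros x hx.
  - rewrite h0 by exact hx. simpl; ring.
  - assert (L : is_derive (fun y => y * a (S k) y) x
                  (1 * a (S k) x + x * - a (S (S k)) x)).
    { apply (is_derive_mult_R (fun y => y)); [apply (is_derive_id x)|auto]. }
    assert (Rt : is_derive (fun y => y * a (S k) y) x
                  ((INR k + q) * - a (S k) x - - b (S k) x)).
    { apply is_derive_ext_pos with (fun y => (INR k + q) * a k y - b k y);
        [exact hx|intros y hy; symmetry; now apply IH|].
      apply (is_derive_minus (fun y => (INR k + q) * a k y) (b k)); [|auto].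
      apply is_derive_scal; auto. }
    apply is_derive_unique in L. apply is_derive_unique in Rt.
    rewrite S_INR. lra.
Qed.

Lemma nonneg_of_euler_equation (a b : nat -> R -> R) (q : R) :
  0 <= q ->
  (forall k x, 0 < x -> is_derive (a k) x (- a (S k) x)) ->
  (forall k x, 0 < x -> is_derive (b k) x (- b (S k) x)) ->
  (forall x, 0 < x -> x * a 1%nat x = q * a 0%nat x - b 0%nat x) ->
  (forall k x, 0 < x -> 0 <= b k x) ->
  (forall x, 0 < x -> 0 <= a 0%nat x) ->
  forall k x, 0 < x -> 0 <= a k x.
Proof.
  intros hq da db h0 hb ha0.
  pose proof (euler_equation_iterate a b q da db h0) as E.
  induction k as [|k IH]; [exact ha0|].
  apply (nonneg_neg_derive_of_nondecreasing (a k) (a (S k)) (INR k + q)); auto.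
  - pose proof (pos_INR k); lra.
  - (* The derivative of t^(k+1+q) a_(k+1) is t^(k+q) b_(k+1). *)
    intros x y hx hxy.
    apply (nondecreasing_of_derive
             (fun t => Rpower t (INR k + q + 1) * a (S k) t)
             (fun t => Rpower t (INR k + q) * b (S k) t)); [exact hxy| |].
    + intros t ht. assert (ht0 : 0 < t) by lra.
      replace (Rpower t (INR k + q) * b (S k) t)
        with ((INR k + q + 1) * Rpower t (INR k + q + 1 - 1) * a (S k) t +
              Rpower t (INR k + q + 1) * - a (S (S k)) t).
      * apply is_derive_Rpower_mult; auto.
      * replace (INR k + q + 1 - 1) with (INR k + q) by ring.
        rewrite (Rpower_plus (INR k + q) 1), Rpower_1 by exact ht0.
        pose proof (E (S k) t ht0) as Et. rewrite S_INR in Et.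
        replace (b (S k) t)
          with ((INR k + 1 + q) * a (S k) t - t * a (S (S k)) t) by lra.
        ring.
    + intros t ht. apply Rmult_le_pos; [apply Rlt_le, exp_pos|].
      apply hb; lra.
Qed.

(** * Generalized Bernstein functions *)

Lemma is_derive_smooth_pos (f : R -> R) (x : R) :
  smooth_pos f -> 0 < x -> is_derive f x (Derive f x).
Proof. intros hs hx. apply Derive_correct. exact (hs 1%nat x hx). Qed.

Lemma gen_bernstein_derive_alternating (mu : R) (f : R -> R) (n : nat) :
  mu <= 1 -> gen_bernstein mu f -> alternating (Rle 0) n (Derive f).
Proof.
  intros hmu [_ [_ hh]].
  apply alternating_ext with
    (fun x => Rpower x (mu - 1) * (Rpower x (1 - mu) * Derive f x)).
  - intros x hx. rewrite <- Rmult_assoc, <- Rpower_plus.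
    replace (mu - 1 + (1 - mu)) with 0 by ring.
    rewrite Rpower_O by exact hx. ring.
  - apply alternating_mult; [apply semicone_nonneg| |].
    + apply alternating_Rpower_id; [apply semicone_nonneg|lra].
    + now apply completely_monotonic_alternating.
Qed.

(** Here the Euler equation is [x G' + mu G = x^(1-mu) f'] for
    [G = x^(-mu) f]. *)
Lemma gen_bernstein_quotient_completely_monotonic (mu : R) (f : R -> R) :
  0 <= mu -> gen_bernstein mu f ->
  completely_monotonic (fun x => Rpower x (- mu) * f x).
Proof.
  intros hmu [hpos [hs [hhs hh]]].
  set (G := fun x => Rpower x (- mu) * f x).
  set (h := fun x => Rpower x (1 - mu) * Derive f x) in *.
  assert (hG : smooth_pos G).
  { apply smooth_pos_alternating; intros n.
    apply alternating_mult; [apply semicone_anyreal| |].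
    - now apply alternating_Rpower_id; [apply semicone_anyreal|].
    - now apply smooth_pos_alternating. }
  split; [exact hG|].
  apply (nonneg_of_euler_equation
           (fun k x => (-1) ^ k * Derive_n G k x)
           (fun k x => (-1) ^ k * Derive_n h k x) mu); auto.
  - intros; now apply is_derive_signed_Derive_n.
  - intros; now apply is_derive_signed_Derive_n.
  - intros x hx; simpl.
    assert (D : is_derive G x (- mu * Rpower x (- mu - 1) * f x +
                               Rpower x (- mu) * Derive f x)).
    { apply is_derive_Rpower_mult; [exact hx|].
      now apply is_derive_smooth_pos. }
    rewrite (is_derive_unique _ _ _ D : Derive (fun y => G y) x = _).
    unfold G, h.
    assert (e1 : Rpower x (- mu) = Rpower x (- mu - 1) * x).
    { replace (- mu) with (- mu - 1 + 1) at 1 by ring.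
      now rewrite Rpower_plus, Rpower_1. }
    replace (1 - mu) with (- mu + 1) by ring.
    rewrite (Rpower_plus (- mu) 1), Rpower_1, e1 by exact hx. ring.
  - intros x hx; simpl. rewrite Rmult_1_l.
    apply Rmult_le_pos; apply Rlt_le; [apply exp_pos|auto].
Qed.

(** The powers of [x] are split so that each of the [m] factors [f] extracted
    from [f^(lambda-1)] receives [x^(-mu)], and [f'] receives [x^(1-mu)]. *)
Lemma power_factorization (x y d mu lambda : R) (m : nat) :
  0 < x -> 0 < y ->
  Rpower x (1 - mu * (INR m + 1)) * (lambda * Rpower y (lambda - 1) * d) =
  lambda * ((Rpower x (- mu) * y) ^ m *
            (Rpower y (lambda - INR m - 1) * (Rpower x (1 - mu) * d))).
Proof.
  intros hx hy.
  rewrite Rpow_mult_distr, <- (Rpower_pow m (Rpower x (- mu))) by apply exp_pos.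
  rewrite Rpower_mult, <- (Rpower_pow m y) by exact hy.
  replace (1 - mu * (INR m + 1)) with (- mu * INR m + (1 - mu)) by ring.
  replace (lambda - 1) with (INR m + (lambda - INR m - 1)) by ring.
  rewrite !(Rpower_plus (- mu * INR m)), !(Rpower_plus (INR m)). ring.
Qed.

Lemma Int_part_nonneg_INR (r : R) :
  0 <= r -> exists m : nat, IZR (Int_part r) = INR m.
Proof.
  intros hr. destruct (base_Int_part r) as [_ h].
  assert (0 <= Int_part r)%Z.
  { apply Z.lt_succ_r, lt_IZR. rewrite succ_IZR. lra. }
  exists (Z.to_nat (Int_part r)). rewrite INR_IZR_INZ, Z2Nat.id; auto.
Qed.

Theorem proposition5p7 (f : R -> R) (mu lambda : R)
    (hmu0 : 0 < mu) (hmu1 : mu <= 1) (hf : gen_bernstein mu f)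
    (hlambda : 0 < lambda) :
  gen_bernstein (mu * (IZR (Int_part lambda) + 1))
    (fun x => Rpower (f x) lambda).
Proof.
  pose proof (fun n => gen_bernstein_derive_alternating mu f n hmu1 hf) as hf1.
  pose proof (gen_bernstein_quotient_completely_monotonic mu f
                (Rlt_le _ _ hmu0) hf) as hG.
  destruct hf as [hpos [hs hh]].
  assert (hd : forall x, 0 < x -> is_derive f x (Derive f x))
    by (intros; now apply is_derive_smooth_pos).
  split; [intros; apply exp_pos|split].
  - apply smooth_pos_alternating; intros n.
    apply (alternating_Rpower anyreal f (Derive f)); auto.
    + apply semicone_anyreal.
    + intros k. apply alternating_weaken with (Rle 0); [now intros|auto].
    + exact I.
  - destruct (Int_part_nonneg_INR lambda) as [m hm]; [lra|].
    destruct (base_Int_part lambda) as [_ hfrac]. rewrite hm in *.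
    apply completely_monotonic_alternating; intros n.
    apply alternating_ext with
      (fun x => lambda * ((Rpower x (- mu) * f x) ^ m *
                          (Rpower (f x) (lambda - INR m - 1) *
                           (Rpower x (1 - mu) * Derive f x)))).
    + intros x hx.
      assert (D : Derive (fun y => Rpower (f y) lambda) x =
                  lambda * Rpower (f x) (lambda - 1) * Derive f x).
      { apply is_derive_unique, is_derive_Rpower_comp; auto. }
      rewrite D. symmetry; apply power_factorization; auto.
    + apply alternating_mult; [apply semicone_nonneg| |].
      { apply alternating_const; [apply semicone_nonneg|lra]. }
      apply alternating_mult; [apply semicone_nonneg| |].
      { apply alternating_pow; [apply semicone_nonneg|].
        now apply completely_monotonic_alternating. }
      apply alternating_mult; [apply semicone_nonneg| |].
      * apply (alternating_Rpower (Rle 0) f (Derive f)); auto.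
        -- apply semicone_nonneg.
        -- lra.
      * now apply completely_monotonic_alternating.
Qed.
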